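(* Consider a connected electric network with $n$ buses and bus admittance matrix $\mathbf{Y}\in\mathbb{C}^{n\times n}$, with no operation constraints, and let $$\mathcal{P}=\{\mathbf{p}\in\mathbb{R}^n : \mathbf{p}=\operatorname{Re}(\operatorname{diag}(\mathbf{v}\mathbf{v}^H\mathbf{Y}^H))\ \text{for some } \mathbf{v}\in\mathbb{C}^n\}$$ be its injection region. (i) If the network is lossy (every line has non-zero resistance), then $$\mathcal{P}=\Big\{\mathbf{p}\in\mathbb{R}^n : \sum_{i=1}^n P_i>0\Big\}\cup\{\mathbf{0}\}.$$ Therefore $\mathcal{P}$ is the union of the open upper half space of $\mathbb{R}^n$ and the origin $\mathbf{0}$; this region is connected and convex. (ii) If the network is lossless, then $$\mathcal{P}=\Big\{\mathbf{p}\in\mathbb{R}^n : \sum_{i=1}^n P_i=0\Big\}.$$ Therefore $\mathcal{P}$ is a hyperplane through the origin.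
   Context: A network is a connected undirected graph on buses $1,\dots,n$; write $i\sim k$ if distinct buses $i,k$ are joined by a transmission line and $i\nsim k$ otherwise. The line $i\sim k$ has complex impedance $z_{ik}=z_{ki}$ and admittance $y_{ik}=y_{ki}=1/z_{ik}=g_{ik}+jb_{ik}$, where $j=\sqrt{-1}$, $g_{ik}\ge 0$, and $b_{ik}<0$ (lines are inductive); its resistance is the real part of $z_{ik}$, which is non-zero exactly when $g_{ik}>0$. Let $y_{ii}$ denote the shunt admittance of bus $i$ to ground. The bus admittance matrix $\mathbf{Y}$ is the symmetric matrix with $Y_{ii}=\sum_{l\sim i}y_{il}+y_{ii}$, $Y_{ik}=-y_{ik}$ if $i\sim k$, and $Y_{ik}=0$ if $i\ne k$ and $i\nsim k$. The network is lossless if the entries of $\mathbf{Y}$ are purely imaginary. The vector $\mathbf{v}=(V_1,\dots,V_n)$ is the vector of complex bus voltages and $\mathbf{p}=(P_1,\dots,P_n)$ the vector of real power injections at the buses. $(\cdot)^H$ is the conjugate transpose, $\operatorname{diag}(\mathbf{M})$ is the vector of diagonal entries of a square matrix $\mathbf{M}$, and $\operatorname{Re}$ is applied entrywise.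
   Formalization: Part (i) is proved for n ≥ 2 and shunt admittances with zero real part; it fails otherwise: a one-bus network with zero shunt has P = {0}, and for two buses with shunt conductances > 0, Re Y is positive definite, so P is not the half space. *)

(* Defs.v *)
From mathcomp Require Import all_boot all_order all_algebra.
From mathcomp Require Import complex.
From mathcomp Require Import all_classical all_reals all_analysis.

Set Implicit Arguments.
Unset Strict Implicit.
Unset Printing Implicit Defensive.

Import Order.TTheory GRing.Theory Num.Theory.
Import numFieldNormedType.Exports.

Local Open Scope ring_scope.
Local Open Scope classical_set_scope.
Local Open Scope complex_scope.
Local Open Scope sesquilinear_scope.

(* [impedance i k] is only meaningful when [line i k]; a line cannot have
   impedance 0, since 0^-1 = 0 would contradict [susceptance_lt0]. *)
Record network (R : realType) (n : nat) := Network {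
  line : rel 'I_n;
  impedance : 'I_n -> 'I_n -> R[i];
  shunt : 'I_n -> R[i];
  bus_gt0 : (0 < n)%N;
  line_sym : symmetric line;
  line_irr : irreflexive line;
  line_connected : forall i k, connect line i k;
  impedance_sym : forall i k, line i k -> impedance i k = impedance k i;
  conductance_ge0 : forall i k, line i k -> 0 <= complex.Re (impedance i k)^-1;
  susceptance_lt0 : forall i k, line i k -> complex.Im (impedance i k)^-1 < 0
}.

Section Network.
Context {R : realType} {n : nat}.
Implicit Type N : network R n.

Definition admittance N (i k : 'I_n) : R[i] := (impedance N i k)^-1.

Definition resistance N (i k : 'I_n) : R := complex.Re (impedance N i k).

Definition admittance_mx N : 'M[R[i]]_n :=
  \matrix_(i, k)
    if i == k then \sum_(l | line N l i) admittance N i l + shunt N i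
    else if line N i k then - admittance N i k else 0.

Definition lossy N : Prop := forall i k, line N i k -> resistance N i k != 0.

Definition lossless N : Prop :=
  forall i k, complex.Re (admittance_mx N i k) = 0.

(* Reactive shunts are allowed, but active power is dissipated in lines only.
   In a lossy network with conductances >= 0, a positive shunt conductance
   would bound |p| by a multiple of the total injection,
   so the injection region could not be a half space. *)
Definition shunts_lossless N : Prop := forall i, complex.Re (shunt N i) = 0.

Definition diagv (A : 'M[R[i]]_n) : 'cV[R[i]]_n := \col_i A i i.

Definition injection N (v : 'cV[R[i]]_n) : 'cV[R]_n :=
  map_mx (@complex.Re R) (diagv (v *m v ^t* *m (admittance_mx N) ^t*)).

Definition injection_region N : set 'cV[R]_n := range (injection N).

Definition hyperplane_through0 (A : set 'cV[R]_n) : Prop :=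
  exists2 a : 'cV[R]_n, a != 0 & A = [set p | \sum_i a i 0 * p i 0 = 0].

End Network.

(* Main.v *)
(** Write [v = x + j t] and [Y = G - j B] up to lossless shunts, where [G] and
    [B] are the Laplacians of the network weighted by conductances and by
    negated susceptances. Then
      [P_i = x_i (G x + B t)_i + t_i (G t - B x)_i],
    and since [B] is symmetric the total injection is [x^T G x + t^T G t].

    Lossless case ([G = 0]): taking [x = 1] gives [P = B t], and [B] maps onto
    the zero-sum vectors because the network is connected.

    Lossy case: the total is nonnegative, and it vanishes only if [x] and [t]
    are constant, when [P = 0]. Conversely, let [p] have positive sum. Both
    Laplacians kill constants, so adding a constant [s] to [x] adds
    [s (G x + B t)] to [P]. Fix a nonconstant [t], and choose [x = a(q)] affine
    in [q] with [G a(q) + B t = q] for every zero-sum [q]. It suffices to solve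
    [s q + P(a(q), t) = lam p] with [lam > 0], since [P] is homogeneous of
    degree 2. Comparing sums forces [lam = (sum P(a(q), t)) / (sum p) > 0], so
    the equation reads [q = s^-1 F(q)] with [F] quadratic and zero-sum valued,
    and for large [s] the right-hand side is a contraction of the unit ball. *)

Require Import Defs.
From HB Require Import structures.
From mathcomp Require Import all_boot all_order all_algebra.
From mathcomp Require Import complex ring lra.
From mathcomp Require Import all_classical all_reals all_analysis.
Import Order.TTheory GRing.Theory Num.Theory.
Import numFieldNormedType.Exports.
Local Open Scope ring_scope.
Local Open Scope classical_set_scope.

Set Implicit Arguments.
Unset Strict Implicit.
Unset Printing Implicit Defensive.

(** * Weighted graph Laplacians *)

Section Laplacian.
Context {R : realFieldType} {n : nat}.
Implicit Types (c : 'M[R]_n) (x y : 'cV[R]_n).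

Definition laplacian c : 'M[R]_n := diag_mx (\row_i \sum_k c i k) - c.

Lemma laplacianE c x i :
  (laplacian c *m x) i 0 = \sum_k c i k * (x i 0 - x k 0).
Proof.
rewrite mulmxBl mul_diag_mx !mxE mulr_suml -sumrB.
by apply: eq_bigr => k _; rewrite mulrBr.
Qed.

Lemma laplacian_tr c : c^T = c -> (laplacian c)^T = laplacian c.
Proof. by move=> cs; rewrite /laplacian linearB /= tr_diag_mx cs. Qed.

Lemma laplacian_const c a : laplacian c *m const_mx a = 0 :> 'cV[R]_n.
Proof.
apply/matrixP => i j; rewrite ord1 laplacianE [RHS]mxE big1// => k _.
by rewrite !mxE subrr mulr0.
Qed.

Lemma sum_dot x y : \sum_i x i 0 * y i 0 = (x^T *m y) 0 0.
Proof. by rewrite mxE; apply: eq_bigr => i _; rewrite mxE. Qed.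

Lemma sum_sym_dot (A : 'M[R]_n) x y : A^T = A ->
  \sum_i x i 0 * (A *m y) i 0 = \sum_i y i 0 * (A *m x) i 0.
Proof.
move=> As; rewrite !sum_dot.
have -> : y^T *m (A *m x) = (x^T *m (A *m y))^T.
  by rewrite !trmx_mul trmxK As mulmxA.
by rewrite [RHS]mxE.
Qed.

(** Pair with the all-ones vector and move the Laplacian across by symmetry, where it kills the
    constant. *)
Lemma laplacian_sum c x : c^T = c -> \sum_i (laplacian c *m x) i 0 = 0.
Proof.
move=> cs; transitivity
    (\sum_i (const_mx 1 : 'cV[R]_n) i 0 * (laplacian c *m x) i 0).
  by apply: eq_bigr => i _; rewrite [const_mx _ _ _]mxE mul1r.
rewrite sum_sym_dot ?laplacian_tr// laplacian_const big1// => i _.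
by rewrite [X in _ * X]mxE mulr0.
Qed.

(** Write the form as a double sum, exchange [i] and [k] in a second copy, and add: the two summands
    combine into a square. *)
Lemma laplacian_form c x : c^T = c ->
  \sum_i x i 0 * (laplacian c *m x) i 0 =
  2^-1 * \sum_i \sum_k c i k * (x i 0 - x k 0) ^+ 2.
Proof.
move=> cs; have csE i k : c k i = c i k by rewrite -[in RHS]cs mxE.
set E := LHS; suff -> : \sum_i \sum_k c i k * (x i 0 - x k 0) ^+ 2 = E + E.
  by field.
have E1 : E = \sum_i \sum_k c i k * (x i 0 * (x i 0 - x k 0)).
  apply: eq_bigr => i _; rewrite laplacianE mulr_sumr.
  by apply: eq_bigr => k _; rewrite mulrCA.
rewrite {1}E1 E1 [X in _ = _ + X]exchange_big -big_split /=.
apply: eq_bigr => i _; rewrite -big_split /=.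
by apply: eq_bigr => k _; rewrite csE; ring.
Qed.

Section Connected.
Context (e : rel 'I_n) (c : 'M[R]_n).
Context (e_connected : forall i k, connect e i k) (c_sym : c^T = c).
Context (c_ge0 : forall i k, 0 <= c i k).
Context (c_gt0 : forall i k, e i k -> 0 < c i k).

Lemma laplacian_form_ge0 x : 0 <= \sum_i x i 0 * (laplacian c *m x) i 0.
Proof.
rewrite laplacian_form// mulr_ge0 ?invr_ge0//.
by do 2![apply: sumr_ge0 => ? _]; rewrite mulr_ge0 ?sqr_ge0.
Qed.

(** Every weighted square vanishes, so [x] agrees across each edge, hence along each path. *)
Lemma laplacian_form_eq0 x : \sum_i x i 0 * (laplacian c *m x) i 0 = 0 ->
  forall i k, x i 0 = x k 0.
Proof.
rewrite laplacian_form// => /eqP; rewrite mulf_eq0 invr_eq0 pnatr_eq0 /=.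
have term_ge0 i k : 0 <= c i k * (x i 0 - x k 0) ^+ 2.
  by rewrite mulr_ge0 ?sqr_ge0.
rewrite psumr_eq0 => [/allP x0|i _]; last exact: sumr_ge0.
have x_edge i k : e i k -> x i 0 = x k 0.
  move=> eik; move: (x0 i (mem_index_enum _)) => /=.
  rewrite psumr_eq0// => /allP/(_ k (mem_index_enum _))/=.
  by rewrite mulf_eq0 gt_eqF ?c_gt0//= sqrf_eq0 subr_eq0 => /eqP.
move=> i k; case/connectP: (e_connected i k) => s es ->.
by elim: s i es => //= j s IH i /andP[/x_edge-> /IH].
Qed.

(* Adding the all-ones matrix makes the Laplacian invertible without changing
   its action on the preimage of the zero-sum vectors. *)
Lemma laplacian_right_inverse : exists H : 'M[R]_n, forall q : 'cV[R]_n,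
  \sum_i q i 0 = 0 -> laplacian c *m (H *m q) = q.
Proof.
case: (posnP n) => [n0|n_gt0].
  exists 0 => q _; apply/matrixP => i; have := ltn_ord i.
  by rewrite [X in (_ < X)%N]n0.
pose A := laplacian c + const_mx 1.
have AE x : A *m x = laplacian c *m x + const_mx (\sum_i x i 0).
  rewrite mulmxDl; congr (_ + _); apply/matrixP => i j.
  by rewrite ord1 !mxE; apply: eq_bigr => k _; rewrite mxE mul1r.
(* The Laplacian part sums to zero, which leaves [n] times the sum of [x]. *)
have Asum x : \sum_i (A *m x) i 0 = 0 -> \sum_i x i 0 = 0.
  move=> /eqP; rewrite AE (eq_bigr (fun i : 'I_n =>
    (laplacian c *m x) i 0 + \sum_i x i 0)) => [|i _]; last first.
    by rewrite mxE [X in _ + X]mxE.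
  rewrite big_split /= laplacian_sum// add0r sumr_const card_ord mulrn_eq0.
  by rewrite eqn0Ngt n_gt0 => /eqP.
have Aker x : A *m x = 0 -> x = 0.
  move=> Ax0; have x_sum : \sum_i x i 0 = 0.
    by apply: Asum; rewrite Ax0 big1// => i _; rewrite mxE.
  have Lx : laplacian c *m x = 0.
    by move: Ax0; rewrite AE x_sum -[const_mx 0]/(0 : 'cV[R]_n) addr0.
  have x_const : forall i k, x i 0 = x k 0.
    by apply: laplacian_form_eq0; rewrite Lx big1// => i _; rewrite mxE mulr0.
  apply/matrixP => i j; rewrite ord1 mxE; move/eqP: x_sum.
  rewrite (eq_bigr (fun=> x i 0)) => [|k _]; last exact: x_const.
  by rewrite sumr_const card_ord mulrn_eq0 eqn0Ngt n_gt0 => /eqP.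
have A_unit : A \in unitmx.
  (* Rows of the left kernel of [A^T], once transposed, lie in the kernel of [A], which is trivial
     by [Aker]. *)
  rewrite -unitmx_tr -row_free_unit -kermx_eq0; apply/eqP/trmx_inj.
  have /row_matrixP rK : kermx A^T *m A^T = 0 by exact: mulmx_ker.
  rewrite trmx0; apply/matrixP => i j; rewrite [RHS]mxE mxE.
  have : A *m (row j (kermx A^T))^T = 0.
    by apply/trmx_inj; rewrite trmx_mul trmxK trmx0 -row_mul rK row0.
  by move=> /Aker/(congr1 (fun B : 'cV_n => B i 0)); rewrite !mxE.
exists (invmx A) => q q_sum.
have Aq : A *m (invmx A *m q) = q by rewrite mulKVmx.
have := AE (invmx A *m q); rewrite Aq Asum ?Aq//.
by rewrite -[const_mx 0]/(0 : 'cV[R]_n) addr0.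
Qed.

End Connected.
End Laplacian.

(* Triggers the join instance [completeNormedModType] on matrices, which
   [banach_fixed_point] needs. *)
HB.instance Definition _ (R : realType) m n := Complete.on 'M[R]_(m, n).

(** * Fixed points of small multiples of locally Lipschitz maps *)

Section SmallFixpoint.
Context {R : realType}.

(** Only the closed unit ball matters. Keeping a bound next to the Lipschitz estimate makes the
    class closed under products, so it contains all polynomials in the coordinates. *)
Definition bounded_lipschitz {V : normedModType R} (f : V -> R) :=
  exists K : R, forall x y : V, `|x| <= 1 -> `|y| <= 1 ->
    `|f x| <= K /\ `|f x - f y| <= K * `|x - y|.

Section Closure.
Context {V : normedModType R}.
Implicit Types f g : V -> R.

Lemma bounded_lipschitz_cst a : bounded_lipschitz (fun _ : V => a).
Proof.
by exists `|a| => x y _ _; rewrite lexx subrr normr0 mulr_ge0.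
Qed.

Lemma bounded_lipschitzD f g : bounded_lipschitz f -> bounded_lipschitz g ->
  bounded_lipschitz (fun x => f x + g x).
Proof.
move=> [K fK] [L gL]; exists (K + L) => x y x1 y1.
rewrite /=; have [fx fxy] := fK x y x1 y1; have [gx gxy] := gL x y x1 y1.
rewrite (le_trans (ler_normD _ _) (lerD fx gx)); split=> //.
by rewrite opprD addrACA mulrDl (le_trans (ler_normD _ _))// lerD.
Qed.

Lemma bounded_lipschitzM f g : bounded_lipschitz f -> bounded_lipschitz g ->
  bounded_lipschitz (fun x => f x * g x).
Proof.
move=> [K fK] [L gL]; exists (K * L + K * L) => x y x1 y1.
rewrite /=; have [fx fxy] := fK x y x1 y1; have [gx gxy] := gL x y x1 y1.
have [gy _] := gL y y y1 y1.
have K0 : 0 <= K := le_trans (normr_ge0 _) fx.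
have L0 : 0 <= L := le_trans (normr_ge0 _) gx.
split; first by rewrite normrM (le_trans (ler_pM _ _ fx gx))// lerDl mulr_ge0.
have -> : f x * g x - f y * g y = f x * (g x - g y) + (f x - f y) * g y by ring.
rewrite (le_trans (ler_normD _ _))// [leRHS]mulrDl !normrM lerD//.
  by rewrite -mulrA ler_pM.
by rewrite mulrAC ler_pM.
Qed.

Lemma bounded_lipschitz_sum (I : finType) (F : I -> V -> R) :
  (forall i, bounded_lipschitz (F i)) ->
  bounded_lipschitz (fun x => \sum_i F i x).
Proof.
move=> FL; elim: (index_enum I) => [|i s IH].
  by under eq_fun do rewrite big_nil; exact: bounded_lipschitz_cst.
by under eq_fun do rewrite big_cons; exact: bounded_lipschitzD.
Qed.

End Closure.

Lemma le_mx_norm {m n} (x : 'M[R]_(m, n)) i j : `|x i j| <= `|x|.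
Proof.
rewrite [leRHS]/Num.norm /= mx_normrE.
exact: (le_bigmax _ (fun ij => `|x ij.1 ij.2|) (i, j)).
Qed.

Lemma bounded_lipschitz_coord {m n} i j :
  bounded_lipschitz (fun x : 'M[R]_(m, n) => x i j).
Proof.
exists 1 => x y x1 y1; rewrite (le_trans (le_mx_norm _ _ _) x1) mul1r.
by split=> //; rewrite (le_trans _ (le_mx_norm (x - y) i j))// !mxE.
Qed.

Lemma bounded_lipschitz_mulmx {V : normedModType R} {n} (A : 'M[R]_n)
    (f : V -> 'cV[R]_n) i : (forall k, bounded_lipschitz (fun x => f x k 0)) ->
  bounded_lipschitz (fun x => (A *m f x) i 0).
Proof.
move=> fL; under eq_fun do rewrite mxE.
apply: bounded_lipschitz_sum => k.
by apply: bounded_lipschitzM; first exact: bounded_lipschitz_cst.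
Qed.

(** For [e] small enough, [e *: F q] maps the closed unit ball into itself and halves distances, so
    Banach's theorem applies. *)
Lemma small_fixpoint {n} (F : 'cV[R]_n -> 'cV[R]_n) :
  (forall i, bounded_lipschitz (fun x => F x i 0)) ->
  exists2 e : R, 0 < e & exists q, q = e *: F q.
Proof.
move=> /choice[K KP].
(* A single constant dominating every [K i]; the summand 1 keeps it positive even if the sum is
   zero. *)
pose M := 1 + \sum_i `|K i|.
have M1 : 1 <= M by rewrite lerDl sumr_ge0.
have M0 : 0 < M by exact: lt_le_trans M1.
have KM i : K i <= M.
  rewrite (le_trans (ler_norm _))// /M (bigD1 i)//= addrCA lerDl addr_ge0//.
  exact: sumr_ge0.
have mx_le (x : 'cV[R]_n) a : 0 <= a -> (forall i, `|x i 0| <= a) -> `|x| <= a.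
  move=> a0 xa; rewrite [leLHS]/Num.norm /= mx_normrE.
  by apply: bigmax_le => // -[i j] _; rewrite ord1.
pose U : set 'cV[R]_n := [set x | `|x| <= 1].
pose e : R := (2 * M)^-1.
have e0 : 0 < e by rewrite invr_gt0 mulr_gt0.
have eM : e * M = 2^-1 by rewrite /e; field; exact: lt0r_neq0.
pose f (q : 'cV[R]_n) := e *: F q.
have fU : set_fun U U f.
  move=> x /= x1; apply: mx_le => // i.
  rewrite mxE normrM (gtr0_norm e0) (le_trans (y := e * M))//; last first.
    by rewrite eM; lra.
  by rewrite ler_pM2l// (le_trans (KP i x x x1 x1).1).
pose fUU := HB.pack_for {fun U >-> U} f (isFun.Build _ _ _ _ _ fU).
have [|||q _ qE] := @banach_fixed_point R _ U fUU; last first.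
- by exists e => //; exists q.
- by exists 0; rewrite /U /= normr0.
- have -> : U = closed_ball_ Num.norm 0 1.
    by apply/seteqP; split=> x; rewrite /U /closed_ball_ /= sub0r normrN.
  exact: closed_closed_ball_.
exists (2^-1)%:nng; split; first by rewrite /=; lra.
move=> [x y] [/= x1 y1].
apply: mx_le => [|i]; first by rewrite mulr_ge0// invr_ge0.
rewrite /f -scalerBr -eM !mxE normrM.
rewrite (gtr0_norm e0) -mulrA ler_pM2l// (le_trans (KP i x y x1 y1).2)//.
by rewrite ler_wpM2r.
Qed.

End SmallFixpoint.

(** * Power injections in real coordinates *)

Section RealPower.
Context {R : realType} {n : nat}.
Implicit Types (G B : 'M[R]_n) (x t p : 'cV[R]_n).

Definition power G B x t : 'cV[R]_n :=
  \col_i (x i 0 * (G *m x + B *m t) i 0 + t i 0 * (G *m t - B *m x) i 0).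

Lemma powerE G B x t i : power G B x t i 0 =
  x i 0 * ((G *m x) i 0 + (B *m t) i 0) + t i 0 * ((G *m t) i 0 - (B *m x) i 0).
Proof. by rewrite !mxE. Qed.

Lemma powerZ G B a x t : power G B (a *: x) (a *: t) = a ^+ 2 *: power G B x t.
Proof.
apply/matrixP => i j; rewrite ord1 /power -!scalemxAr.
by rewrite -scalerDr -scalerBr !mxE; ring.
Qed.

Lemma sum_power G B x t : B^T = B -> \sum_i power G B x t i 0 =
  \sum_i x i 0 * (G *m x) i 0 + \sum_i t i 0 * (G *m t) i 0.
Proof.
move=> Bs; have /eqP := sum_sym_dot x t Bs; rewrite -subr_eq0 => /eqP cross.
rewrite (eq_bigr (fun i => x i 0 * (G *m x) i 0 + t i 0 * (G *m t) i 0 +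
    (x i 0 * (B *m t) i 0 - t i 0 * (B *m x) i 0))) => [|i _].
  by rewrite !big_split /= sumrN cross addr0.
by rewrite powerE; ring.
Qed.

Lemma power_shift G B s x t :
    G *m const_mx s = 0 :> 'cV[R]_n -> B *m const_mx s = 0 :> 'cV[R]_n ->
  power G B (const_mx s + x) t = s *: (G *m x + B *m t) + power G B x t.
Proof.
move=> Gs Bs; apply/matrixP => i j; rewrite ord1 /power !mulmxDr Gs Bs !add0r.
move: (G *m x + B *m t) (G *m t - B *m x) => u w; rewrite !mxE; ring.
Qed.

Lemma power_lossy_surjective G B (H : 'M[R]_n) t0 p : B^T = B ->
    (forall s, G *m const_mx s = 0 :> 'cV[R]_n) ->
    (forall s, B *m const_mx s = 0 :> 'cV[R]_n) ->
    (forall x, \sum_i (B *m x) i 0 = 0) ->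
    (forall x, 0 <= \sum_i x i 0 * (G *m x) i 0) ->
    0 < \sum_i t0 i 0 * (G *m t0) i 0 ->
    (forall q : 'cV[R]_n, \sum_i q i 0 = 0 -> G *m (H *m q) = q) ->
  0 < \sum_i p i 0 -> exists x t, power G B x t = p.
Proof.
move=> Bs G1 B1 Bsum G_ge0 Gt0 GH p_gt0.
have subE (u w : 'cV[R]_n) i : (u - w) i 0 = u i 0 + - w i 0 by rewrite !mxE.
pose a q := H *m (q - B *m t0).
pose P q := power G B (a q) t0.
pose lam q := (\sum_i P q i 0) / \sum_i p i 0.
have PL i : bounded_lipschitz (fun q => P q i 0).
  have aL k : bounded_lipschitz (fun q => a q k 0).
    apply: bounded_lipschitz_mulmx => l; under eq_fun do rewrite subE.
    apply: bounded_lipschitzD; first exact: bounded_lipschitz_coord.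
    exact: bounded_lipschitz_cst.
  (* Negation becomes multiplication by the constant -1, so closure under sums and products
     suffices. *)
  under eq_fun do rewrite powerE -[- _]mulN1r.
  apply: bounded_lipschitzD; apply: bounded_lipschitzM;
    try apply: bounded_lipschitzD; try apply: bounded_lipschitzM;
    try exact: bounded_lipschitz_cst; try exact: aL;
    exact: bounded_lipschitz_mulmx.
(* The factor [e] is the reciprocal of the shift [s]; [lam q] is the factor that makes this map
   zero-sum valued. *)
have [i|e e_gt0 [q qE]] := @small_fixpoint R n (fun q => lam q *: p - P q).
  under eq_fun do rewrite subE mxE -[- _]mulN1r.
  apply: bounded_lipschitzD; apply: bounded_lipschitzM => //;
    try exact: bounded_lipschitz_cst.
  apply: bounded_lipschitzM; last exact: bounded_lipschitz_cst.
  exact: bounded_lipschitz_sum.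
have q_sum : \sum_i q i 0 = 0.
  rewrite qE; under eq_bigr do rewrite mxE subE mxE.
  by rewrite -mulr_sumr sumrB -mulr_sumr divfK ?gt_eqF// subrr mulr0.
have Gaq : G *m a q + B *m t0 = q.
  rewrite /a GH ?subrK//; under eq_bigr do rewrite subE.
  by rewrite sumrB q_sum Bsum subr0.
(* The form of [a q] is nonnegative and that of [t0] strictly positive. *)
have lam_gt0 : 0 < lam q.
  by rewrite divr_gt0// sum_power// ltr_wpDl.
(* Before scaling, the shifted power is [e^-1 *: q + P q = lam q *: p]; by homogeneity of degree 2,
   dividing both arguments by the root of [lam q] leaves [p]. *)
exists ((Num.sqrt (lam q))^-1 *: (const_mx e^-1 + a q)).
exists ((Num.sqrt (lam q))^-1 *: t0).
rewrite powerZ power_shift// Gaq {2}qE scalerA mulVf ?gt_eqF// scale1r subrK.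
by rewrite scalerA exprVn sqr_sqrtr ?ltW// mulVf ?gt_eqF// scale1r.
Qed.

End RealPower.

(** * From complex voltages to real power *)

Lemma Re_sum (R : realType) (I : finType) (P : pred I) (F : I -> R[i]) :
  complex.Re (\sum_(i | P i) F i) = \sum_(i | P i) complex.Re (F i).
Proof. by elim/big_rec2: _ => // i x y _ <-; case: y (F i) => ? ? [? ?]. Qed.

Lemma Im_sum (R : realType) (I : finType) (P : pred I) (F : I -> R[i]) :
  complex.Im (\sum_(i | P i) F i) = \sum_(i | P i) complex.Im (F i).
Proof. by elim/big_rec2: _ => // i x y _ <-; case: y (F i) => ? ? [? ?]. Qed.

Section Injection.
Context {R : realType} {n : nat} (N : network R n).

Definition conductance_mx : 'M[R]_n :=
  \matrix_(i, k) if line N i k then complex.Re (admittance N i k) else 0.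

Definition susceptance_mx : 'M[R]_n :=
  \matrix_(i, k) if line N i k then - complex.Im (admittance N i k) else 0.

Lemma admittance_sym i k : line N i k -> admittance N i k = admittance N k i.
Proof. by move=> ik; rewrite /admittance impedance_sym. Qed.

Lemma conductance_tr : conductance_mx^T = conductance_mx.
Proof.
apply/matrixP => i k; rewrite !mxE line_sym.
by case: ifP => // /admittance_sym->.
Qed.

Lemma susceptance_tr : susceptance_mx^T = susceptance_mx.
Proof.
apply/matrixP => i k; rewrite !mxE line_sym.
by case: ifP => // /admittance_sym->.
Qed.

Lemma conductance_mx_ge0 i k : 0 <= conductance_mx i k.
Proof. by rewrite mxE; case: ifP => // /conductance_ge0. Qed.

Lemma susceptance_mx_gt0 i k : line N i k -> 0 < susceptance_mx i k.
Proof. by rewrite mxE => ik; rewrite ik oppr_gt0 susceptance_lt0. Qed.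

Lemma susceptance_mx_ge0 i k : 0 <= susceptance_mx i k.
Proof.
case: (boolP (line N i k)) => [/susceptance_mx_gt0/ltW//|ik].
by rewrite mxE (negbTE ik).
Qed.

(** For [z = r + j x] the real part of [z^-1] is [r / (r^2 + x^2)], nonzero when [r] is; its sign is
    already known. *)
Lemma conductance_mx_gt0 i k : lossy N -> line N i k -> 0 < conductance_mx i k.
Proof.
move=> Nlossy ik; rewrite lt0r conductance_mx_ge0 andbT mxE ik /admittance.
have := Nlossy _ _ ik; rewrite /resistance.
case: (impedance N i k) => r x /= r0.
rewrite mulf_neq0// invr_eq0 paddr_eq0 ?sqr_ge0// sqrf_eq0 negb_and.
by rewrite r0.
Qed.

Lemma admittance_mxE i k : admittance_mx N i k =
  Complex (laplacian conductance_mx i k + (i == k)%:R * complex.Re (shunt N i))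
          ((i == k)%:R * complex.Im (shunt N i) - laplacian susceptance_mx i k).
Proof.
rewrite /laplacian !mxE; case: eqVneq => [<-|ik]; last first.
  rewrite !mul0r !mulr0n !sub0r addr0 opprK; case: ifP => _.
    by case: (admittance N i k).
  by rewrite oppr0.
rewrite line_irr !subr0 !mulr1n !mul1r.
under [\sum_k conductance_mx i k]eq_bigr do rewrite mxE line_sym.
under [\sum_k susceptance_mx i k]eq_bigr do rewrite mxE line_sym.
rewrite -!big_mkcond /= sumrN opprK -Re_sum -Im_sum.
by case: (\sum_(l | _) _) (shunt N i) => a b [c d] /=; rewrite [d + b]addrC.
Qed.

Lemma injectionE (v : 'cV[R[i]]_n) : shunts_lossless N ->
  injection N v = power (laplacian conductance_mx) (laplacian susceptance_mx)
    (map_mx (@complex.Re R) v) (map_mx (@complex.Im R) v).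
Proof.
move=> shunt0; apply/matrixP => i j; rewrite ord1 powerE.
transitivity (\sum_k complex.Re
    (v i 0 * Num.conj (v k 0) * Num.conj (admittance_mx N i k))).
  rewrite !mxE Re_sum; apply: eq_bigr => k _.
  by rewrite mxE big_ord1 !mxE.
under eq_bigr do rewrite admittance_mxE shunt0 mulr0 addr0.
move: (laplacian conductance_mx) (laplacian susceptance_mx) => G B.
rewrite !mxE -sumrB -big_split /= !mulr_sumr -big_split /=.
apply: eq_bigr => k _; rewrite !mxE.
(* The shunt enters only for [k = i], where an imaginary number multiplies the squared modulus of
   [v i 0] and adds no real power. *)
case: eqVneq => [<-|_].
  by case: (v i 0) => x t /=; ring.
by case: (v i 0) (v k 0) => x t [y u] /=; ring.
Qed.

End Injection.

(** * Topology and convexity of the half space with the origin *)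

(** The set is a union of segments that all contain the origin. *)
Lemma star_connected (R : realType) (V : normedModType R) (S : set V) :
    (forall p (l : R), S p -> 0 <= l <= 1 -> S (l *: p)) ->
  connected S.
Proof.
move=> S_star.
have -> : S = \bigcup_(p in S) ((fun l : R => l *: p) @` `[0, 1]).
  apply/seteqP; split=> [p Sp|p [q Sq [l l01 <-]]].
    by exists p => //; exists 1; rewrite ?scale1r//= in_itv/= ler01 lexx.
  by apply: S_star => //; move: l01; rewrite /= in_itv.
apply: bigcup_connected => [|p _].
  by exists 0 => p _; exists 0; rewrite ?scale0r//= in_itv/= ler01 lexx.
apply: connected_continuous_connected; first exact: segment_connected.
apply: continuous_subspaceT => l; exact: scalel_continuous.
Qed.

(** Both weights may be taken strictly positive, so one endpoint in the open half space already
    makes the sum of the combination positive. *)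
Lemma convex_open_half_spaceU0 (R : realType) (n : nat) :
  convex_set ([set p : 'cV[R]_n | 0 < \sum_i p i 0] `|` [set 0]).
Proof.
apply/convex_setW => x y xS yS k k0 k1; move: xS yS; rewrite !inE => xS yS.
rewrite -[conv k x y]/
  (k%:num *: (x : 'cV[R]_n) + (1 - k%:num) *: (y : 'cV[R]_n)).
pose l := k%:num; rewrite -/l in k0 k1 *; clearbody l => {k}.
have sumE (u w : 'cV[R]_n) : \sum_i (l *: u + (1 - l) *: w) i 0 =
    l * (\sum_i u i 0) + (1 - l) * \sum_i w i 0.
  by rewrite !mulr_sumr -big_split; apply: eq_bigr => i _; rewrite !mxE.
have k1' : 0 < 1 - l by rewrite subr_gt0.
have sum0 : \sum_i (0 : 'cV[R]_n) i 0 = 0 by rewrite big1// => i _; rewrite mxE.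
case: xS yS => [x0|->] [y0|->]; last by right; rewrite !scaler0 addr0.
- by left; rewrite /= sumE addr_gt0// mulr_gt0.
- by left; rewrite /= sumE sum0 mulr0 addr0 mulr_gt0.
- by left; rewrite /= sumE sum0 mulr0 add0r mulr_gt0.
Qed.

(** * The lossy and lossless injection regions *)

Section InjectionRegion.
Context {R : realType} {n : nat} (N : network R n).

Let G := laplacian (conductance_mx N).
Let B := laplacian (susceptance_mx N).

Let B_tr : B^T = B.
Proof. exact/laplacian_tr/susceptance_tr. Qed.

Lemma injection_region_lossy : (1 < n)%N -> shunts_lossless N -> lossy N ->
  injection_region N = [set p : 'cV[R]_n | 0 < \sum_i p i 0] `|` [set 0].
Proof.
move=> n_gt1 shunt0 Nlossy.
have g_gt0 i k : line N i k -> 0 < conductance_mx N i k.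
  exact: conductance_mx_gt0.
have G_ge0 := laplacian_form_ge0 (conductance_tr N) (conductance_mx_ge0 N).
have G_eq0 := laplacian_form_eq0 (line_connected N) (conductance_tr N)
  (conductance_mx_ge0 N) g_gt0.
apply/seteqP; split=> [_ [v _ <-]|p [p_gt0|->]].
- rewrite injectionE// -/G -/B; set x := map_mx _ v; set t := map_mx _ v.
  have [/eqP E0|E0] := boolP (\sum_i power G B x t i 0 == 0); last first.
    by left; rewrite /= lt0r E0 sum_power// addr_ge0.
  right; move/eqP: E0; rewrite sum_power// paddr_eq0//.
  move=> /andP[/eqP xE /eqP tE].
  have const_ker (z : 'cV[R]_n) c : (forall i k, z i 0 = z k 0) ->
      laplacian c *m z = 0.
    move=> z_const; apply/matrixP => i j; rewrite ord1 laplacianE [RHS]mxE.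
    by rewrite big1// => k _; rewrite (z_const i k) subrr mulr0.
  apply/matrixP => i j; rewrite ord1 powerE !const_ker; try exact: G_eq0.
  by rewrite !mxE subrr addr0 !mulr0 addr0.
- have [H GH] := laplacian_right_inverse (line_connected N) (conductance_tr N)
    (conductance_mx_ge0 N) g_gt0.
  (* A nonconstant [t0] requires two distinct buses; on a single bus the region is just the
     origin. *)
  pose i0 := Ordinal (ltnW n_gt1); pose i1 := Ordinal n_gt1.
  pose t0 : 'cV[R]_n := delta_mx i0 0.
  have t0_gt0 : 0 < \sum_i t0 i 0 * (G *m t0) i 0.
    rewrite lt0r G_ge0 andbT; apply/negP => /eqP/G_eq0/(_ i0 i1)/eqP.
    by rewrite !mxE !eqxx /= oner_eq0.
  have [x [t <-]] := power_lossy_surjective B_tr (laplacian_const _)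
    (laplacian_const _) (fun x => laplacian_sum x (susceptance_tr N))
    G_ge0 t0_gt0 GH p_gt0.
  exists (\col_i Complex (x i 0) (t i 0)) => //; rewrite injectionE//.
  by congr power; apply/matrixP => i j; rewrite ord1 !mxE.
- exists 0 => //; rewrite injectionE// !map_mx0.
  (* Zero voltages are written as a zero multiple so that homogeneity applies. *)
  rewrite -[X in power _ _ X X](scale0r 0).
  by rewrite powerZ expr0n scale0r.
Qed.

Lemma injection_region_lossless : lossless N ->
  injection_region N = [set p : 'cV[R]_n | \sum_i p i 0 = 0].
Proof.
move=> Nlossless.
have g0 i k : line N i k -> complex.Re (admittance N i k) = 0.
  move=> ik; have := Nlossless i k; rewrite mxE ik.
  case: eqVneq ik => [->|_ _]; first by rewrite line_irr.
  by case: (admittance N i k) => a b /= /eqP; rewrite oppr_eq0 => /eqP.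
have c0 : conductance_mx N = 0.
  by apply/matrixP => i k; rewrite !mxE; case: ifP => // /g0.
have G0 : G = 0.
  rewrite /G c0 /laplacian subr0; apply/matrixP => i k; rewrite !mxE.
  by rewrite big1 ?mul0rn// => l _; rewrite mxE.
(* With [G = 0], the real part of a diagonal entry of the admittance matrix is that of the shunt
   alone. *)
have shunt0 : shunts_lossless N.
  move=> i; have := Nlossless i i; rewrite admittance_mxE /= -/G G0.
  by rewrite mxE add0r eqxx mul1r.
apply/seteqP; split=> [_ [v _ <-]|p /= p0].
  rewrite /= injectionE// sum_power// -/G G0.
  by rewrite !big1 ?addr0// => i _; rewrite mul0mx [X in _ * X]mxE mulr0.
have [H BH] := laplacian_right_inverse (line_connected N) (susceptance_tr N)
  (susceptance_mx_ge0 N) (@susceptance_mx_gt0 _ _ N).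
exists (\col_i Complex 1 ((H *m p) i 0)) => //; rewrite injectionE// -/G -/B G0.
have -> : map_mx (@complex.Re R) (\col_i Complex 1 ((H *m p) i 0)) = const_mx 1.
  by apply/matrixP => i j; rewrite !mxE.
have -> : map_mx (@complex.Im R) (\col_i Complex 1 ((H *m p) i 0)) = H *m p.
  by apply/matrixP => i j; rewrite ord1 [LHS]mxE [in LHS]mxE.
apply/matrixP => i j; rewrite ord1 powerE laplacian_const BH//.
by rewrite !mul0mx !mxE subr0 mulr0 addr0 add0r mul1r.
Qed.

End InjectionRegion.

Theorem theorem1 (R : realType) (n : nat) (N : network R n) :
  ((1 < n)%N -> shunts_lossless N -> lossy N ->
    [/\ injection_region N =
          [set p : 'cV[R]_n | 0 < \sum_i p i 0] `|` [set 0],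
        connected (injection_region N)
      & convex_set (injection_region N)]) /\
  (lossless N ->
    injection_region N = [set p : 'cV[R]_n | \sum_i p i 0 = 0] /\
    hyperplane_through0 (injection_region N)).
Proof.
split=> [n_gt1 shunt0 Nlossy|Nlossless].
  rewrite injection_region_lossy//; split=> //; last first.
    exact: convex_open_half_spaceU0.
  (* Scaling by a positive [l] keeps the sum positive, while [l = 0] lands on the origin. *)
  apply: star_connected => p l [p0|->] /andP[l0 _]; last first.
    by right; rewrite scaler0.
  move: l0; rewrite le_eqVlt => /predU1P[<-|l0].
    by right; rewrite scale0r.
  left; rewrite /=; under eq_bigr do rewrite mxE.
  by rewrite -mulr_sumr mulr_gt0.
(* The normal vector is all ones, nonzero because there is at least one bus. *)
rewrite injection_region_lossless//; split=> //; exists (const_mx 1).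
  apply/eqP => /matrixP/(_ (Ordinal (bus_gt0 N)) 0)/eqP.
  by rewrite !mxE oner_eq0.
rewrite /= predeqE => p /=.
under [X in _ <-> X = _]eq_bigr do rewrite mxE mul1r.
by [].
Qed.
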